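(* Let $p,q\in(1,\infty)$ and let $n\in\{0,1,2,\ldots\}$. Then, for every real $r\in(-1,q-1]$, \[\int_0^{\pi_{p,q}/2}\sin_{p,q}^{qn+r}t\,dt=\frac{u\,(1/u)_n}{q\,(1/p^*+1/u)_n}\cdot\frac{\pi_{p,u}}{2},\qquad\text{where } \frac1u:=\frac{r+1}{q};\] and for every real $r\in(1-p,1]$, \[\int_0^{\pi_{p,q}/2}\cos_{p,q}^{pn+r}t\,dt=\frac{(1/v)_n}{(1/v+1/q)_n}\cdot\frac{\pi_{v^*,q}}{2},\qquad\text{where } \frac1v:=\frac{r+p-1}{p}.\]
   Context: Generalized trigonometric functions: for $p,q\in(1,\infty)$, $\sin_{p,q}$ is the inverse function of $\sin_{p,q}^{-1}x:=\int_0^x \frac{dt}{(1-t^q)^{1/p}}$, $0\le x\le 1$, and $\pi_{p,q}:=2\sin_{p,q}^{-1}1=2\int_0^1\frac{dt}{(1-t^q)^{1/p}}$. Thus $\sin_{p,q}$ is increasing from $[0,\pi_{p,q}/2]$ onto $[0,1]$. One sets $\cos_{p,q}x:=(\sin_{p,q}x)'$, which satisfies $\cos_{p,q}^p x+\sin_{p,q}^q x=1$ with $\cos_{p,q}x\ge 0$ on $[0,\pi_{p,q}/2]$. Powers are written $\sin_{p,q}^a x=(\sin_{p,q}x)^a$, $\cos_{p,q}^a x=(\cos_{p,q}x)^a$; integrals are improper where an exponent is negative. For $s\in(1,\infty)$, $s^*:=s/(s-1)$. Conventions: $1^*:=\infty$, and for $s\in(1,\infty)$, $\pi_{s,1}:=2s^*$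 and $\pi_{\infty,s}:=2$. The Pochhammer symbol is $(a)_0:=1$, $(a)_n:=a(a+1)\cdots(a+n-1)$ for $n\ge1$. *)

(* Defs.v *)
From HB Require Import structures.
From mathcomp Require Import all_boot all_order all_algebra.
From mathcomp Require Import all_classical all_reals all_analysis.
Set Implicit Arguments.
Unset Strict Implicit.
Unset Printing Implicit Defensive.
Import Order.TTheory GRing.Theory Num.Theory.
Import numFieldNormedType.Exports.
Local Open Scope classical_set_scope.
Local Open Scope ring_scope.

(* All integrands here are nonnegative, so the Lebesgue integral coincides with
   the improper Riemann integral. Since [0 `^ a = 0] for [a != 0] and
   [0^-1 = 0], integrands that blow up at an endpoint get a finite dummy value
   at that single point, which does not affect the integral. *)
Definition arcsin_pq (R : realType) (p q x : R) : R :=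
  \int[lebesgue_measure]_(t in `[0, x]) ((1 - t `^ q) `^ p^-1)^-1.

(* The first index may be [+oo], since the conjugate exponent of 1 is [+oo].
   The values for [p = +oo] and for [q = 1] are the usual conventions. *)
Definition pi_pq (R : realType) (p : \bar R) (q : R) : R :=
  match p with
  | p'%:E => if q == 1 then 2 * fine (hoelder_conjugate p'%:E)
             else 2 * arcsin_pq p' q 1
  | +oo%E => 2
  | -oo%E => 0 (* dummy value *)
  end.

(* The dummy value 0 is used outside [0, pi_pq / 2]. *)
Definition sin_pq (R : realType) (p q : R) : R -> R :=
  'pinv_(fun=> 0) `[0, 1] (arcsin_pq p q).

(* Derivative of [f] as a function on [D]; compare [derive1]. It is one-sided
   at the endpoints of an interval [D]. *)
Definition derive1_on (R : realType) (D : set R) (f : R -> R) (x : R) : R :=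
  lim ((fun h => h^-1 *: (f (h + x) - f x)) @
       within [set h | D (h + x)] 0^').

Definition cos_pq (R : realType) (p q : R) : R -> R :=
  derive1_on `[0, pi_pq p%:E q / 2] (sin_pq p q).

Definition pochhammer (R : realType) (a : R) (n : nat) : R :=
  \prod_(i < n) (a + i%:R).

(* Main.v *)
(* Substituting x = sin_pq t turns both integrals into integrals of
   x^A (1 - x^q)^B over ]0, 1[, and y = x^q turns these into beta integrals
   B(a, b) with one parameter shifted by n. The functional equations of the beta
   integral extract the quotient of Pochhammer symbols, and the remaining value
   B(1/u, 1 - 1/p), resp. B(1/q, 1/v), is again of the form of a half pi_pq. *)
Require Import Defs.
From HB Require Import structures.
From mathcomp Require Import all_boot all_order all_algebra.
From mathcomp Require Import all_classical all_reals all_analysis.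
From mathcomp Require Import measurable_realfun ring lra.
Set Implicit Arguments.
Unset Strict Implicit.
Unset Printing Implicit Defensive.
Import Order.TTheory GRing.Theory Num.Theory.
Import numFieldNormedType.Exports.
Local Open Scope classical_set_scope.
Local Open Scope ring_scope.

(** * Change of variables on open intervals *)

Lemma nested_itvcc_bigcup (R : realType) (a b : R) : a < b ->
  exists u v : nat -> R, [/\ forall n, a < u n /\ u n <= v n /\ v n < b,
    {homo u : m n / (m <= n)%N >-> n <= m},
    {homo v : m n / (m <= n)%N >-> m <= n} &
    forall x, x \in `]a, b[ -> exists n, x \in `[u n, v n]].
Proof.
(* The segments are [[a + s n, b - s n]]; the offset 2 keeps [s n] at most half the length, so
   already the segment for n = 0 is nonempty. *)
move=> ab; pose s n : R := (b - a) / (n.+2)%:R.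
have ba0 : 0 < b - a by rewrite subr_gt0.
have s0 n : 0 < s n by rewrite /s divr_gt0.
have sh n : s n <= (b - a) / 2 by rewrite ler_pM2l// lef_pV2 ?posrE// ler_nat.
have sd : {homo s : m n / (m <= n)%N >-> n <= m}.
  by move=> m n mn; rewrite /s ler_pM2l// lef_pV2 ?posrE// ler_nat ltnS.
exists (fun n => a + s n), (fun n => b - s n); split.
- by move=> n; have := s0 n; have := sh n; split; [lra|split; lra].
- by move=> m n /sd; rewrite lerD2l.
- by move=> m n /sd; rewrite lerD2l lerN2.
move=> x; rewrite in_itv/= => /andP[ax xb].
pose d := Num.min (x - a) (b - x).
have d0 : 0 < d by rewrite lt_min !subr_gt0 ax.
exists (Num.bound ((b - a) / d)); set n := Num.bound _.
have : s n <= d.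
  rewrite /s ler_pdivrMr// mulrC -ler_pdivrMr//.
  apply: le_trans (ltW (archi_boundP _)) _; first by rewrite divr_ge0 ?ltW.
  by rewrite ler_nat -addn2 leq_addr.
by rewrite le_min in_itv/= => /andP[? ?]; apply/andP; split; lra.
Qed.

Section substitution_oo.
Context {R : realType}.
Notation mu := (@lebesgue_measure R).

(** Monotone convergence along an increasing exhaustion by segments. As [f] is nonnegative, the
    limit may be infinite. *)
Lemma ge0_cvg_integral_itvoo (f : R -> R) (a b : R) (u v : nat -> R) :
  {in `]a, b[, continuous f} -> {in `]a, b[, forall x, 0 <= f x} ->
  (forall n, a < u n /\ v n < b) ->
  {homo u : m n / (m <= n)%N >-> n <= m} ->
  {homo v : m n / (m <= n)%N >-> m <= n} ->
  (forall x, x \in `]a, b[ -> exists n, x \in `[u n, v n]) ->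
  (\int[mu]_(x in `[u n, v n]) (f x)%:E)%E @[n --> \oo] -->
  (\int[mu]_(x in `]a, b[) (f x)%:E)%E.
Proof.
move=> cf f0 uv du nv cover.
have sub n : [set` `[u n, v n]] `<=` [set` `]a, b[].
  by have [? ?] := uv n; apply: subset_itv; rewrite bnd_simp.
have -> : [set` `]a, b[] = \bigcup_n [set` `[u n, v n]].
  apply/seteqP; split => [x /= /cover[n xn]|x [n _ /sub]//]; by exists n.
apply: ge0_nondecreasing_set_cvg_integral => //.
- move=> m n mn; rewrite subsetEset; apply: subset_itv; rewrite bnd_simp.
  + exact: du.
  + exact: nv.
- move=> n; apply/measurable_EFinP.
  apply: (measurable_funS _ (sub n)) => //.
  apply: open_continuous_measurable_fun => //.
  by move=> x; rewrite inE; exact: cf.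
- by move=> n x /sub xab; rewrite lee_fin f0.
Qed.

(** On each segment [[u n, v n]] the integrands are continuous and the substitution rule for
    segments applies; monotone convergence then passes to the limit on both sides. Hence [f] and [G]
    may blow up at the endpoints. *)
Lemma integration_by_substitution_oo (F f G : R -> R) (a b : R) : a < b ->
  (forall x : R, x \in `]a, b[ -> is_derive x 1 F (f x)) ->
  {in `]a, b[, continuous f} -> {in `]a, b[, forall x, 0 < f x} ->
  F x @[x --> a^'+] --> F a -> F x @[x --> b^'-] --> F b ->
  {in `]F a, F b[, continuous G} -> {in `]F a, F b[, forall y, 0 <= G y} ->
  (\int[mu]_(y in `]F a, F b[) (G y)%:E =
   \int[mu]_(x in `]a, b[) (G (F x) * f x)%:E)%E.
Proof.
move=> ab dF cf f0 Fa Fb cG G0.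
have derF x : x \in `]a, b[ -> derivable F x 1 by move=> /dF[].
have F'E x : x \in `]a, b[ -> derive1 F x = f x.
  by move=> /dF d; rewrite derive1E; apply: derive_val.
have cF : {within `[a, b], continuous F}.
  apply/continuous_within_itvP => //; split => // x xab.
  exact/differentiable_continuous/derivable1_diffP/derF.
have Fincr : {in `[a, b] &, {homo F : x y / x < y}}.
  apply: gtr0_derive1_lt_cc => // x xab; by rewrite F'E// f0.
have [u [v [uv du nv cover]]] := @nested_itvcc_bigcup R a b ab.
have Flt x y : a <= x -> x < y -> y <= b -> F x < F y.
  move=> ax xy yb.
  rewrite Fincr// in_itv/= ?ax ?yb ?(le_trans ax (ltW xy))//.
  by rewrite (le_trans (ltW xy) yb).
have Fle x y : a <= x -> x <= y -> y <= b -> F x <= F y.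
  move=> ax; rewrite le_eqVlt => /predU1P[->//|xy] yb.
  exact/ltW/Flt.
have sub n : [set` `[u n, v n]] `<=` [set` `]a, b[].
  by have [? [_ ?]] := uv n; apply: subset_itv; rewrite bnd_simp.
have cFin x : x \in `]a, b[ -> {for x, continuous F}.
  by move=> xab; exact/differentiable_continuous/derivable1_diffP/derF.
have Fin x : x \in `]a, b[ -> F x \in `]F a, F b[.
  rewrite !in_itv/= => /andP[ax xb].
  by apply/andP; split; apply: Flt => //; exact: ltW.
have lim1 : (\int[mu]_(y in `[F (u n), F (v n)]) (G y)%:E)%E @[n --> \oo] -->
    (\int[mu]_(y in `]F a, F b[) (G y)%:E)%E.
  apply: ge0_cvg_integral_itvoo => //.
  - move=> n; have [au [uvn vb]] := uv n; split; apply: Flt => //.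
      exact: le_trans uvn (ltW vb).
    exact: le_trans (ltW au) uvn.
  - move=> m n mn; have [? [? ?]] := uv n; have [? [? ?]] := uv m.
    apply: Fle => //; [exact: ltW|exact: du|].
    by apply: le_trans (ltW _); eassumption.
  - move=> m n mn; have [? [? ?]] := uv n; have [? [? ?]] := uv m.
    apply: Fle => //; [|exact: nv|exact: ltW].
    by apply: (le_trans (ltW _)); eassumption.
  (* The images [[F (u n), F (v n)]] exhaust []F a, F b[]: by the intermediate value theorem y = F
     x, and x is interior because y differs from [F a] and [F b]. *)
  - move=> y; rewrite in_itv/= => /andP[Fay yFb].
    have yFab : `[F a, F b]%classic y by rewrite /= in_itv/= !ltW.
    have [x] := segment_continuous_le_surjective (ltW ab)
      (ltW (lt_trans Fay yFb)) cF yFab.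
    rewrite /= in_itv/= => /andP[ax xb] Fxy.
    have xab : x \in `]a, b[.
      rewrite in_itv/= !lt_neqAle ax xb !andbT; apply/andP; split.
        by apply: contraTneq Fay => ->; rewrite Fxy ltxx.
      by apply: contraTneq yFb => <-; rewrite Fxy ltxx.
    have [n] := cover _ xab; rewrite in_itv/= => /andP[unx xvn].
    have [au [_ vb]] := uv n.
    by exists n; rewrite in_itv/= -Fxy !Fle// ltW.
have lim2 : (\int[mu]_(x in `[u n, v n]) (G (F x) * f x)%:E)%E @[n --> \oo] -->
    (\int[mu]_(x in `]a, b[) (G (F x) * f x)%:E)%E.
  apply: (@ge0_cvg_integral_itvoo (fun x => G (F x) * f x)) => //.
  - move=> x xab; apply: continuousM; last exact: cf.
    by apply: continuous_comp; [exact: cFin|exact/cG/Fin].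
  - by move=> x xab; rewrite mulr_ge0 ?G0 ?Fin// ltW ?f0.
  - by move=> n; have [? [? ?]] := uv n.
apply: cvg_unique lim1 _; first exact: ereal_hausdorff.
apply: cvg_trans lim2; apply: near_eq_cvg; apply: nearW => n.
have [au [uvn vb]] := uv n.
have unab : u n \in `]a, b[ by rewrite in_itv/= au (le_lt_trans uvn vb).
have vnab : v n \in `]a, b[ by rewrite in_itv/= vb (lt_le_trans au uvn).
(* [derive1 F] is known to equal [f] only on []a, b[], but this is a neighbourhood of each of its
   points, so continuity carries over. *)
have cF' x : x \in `]a, b[ -> {for x, continuous (derive1 F)}.
  move=> xab; rewrite /prop_for /continuous_at F'E//.
  apply: cvg_trans (cf _ xab); apply: near_eq_cvg.
  by near=> z; rewrite F'E//; near: z; exact: near_in_itvoo.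
rewrite (@integration_by_substitution_increasing _ F G)//.
- apply: eq_integral => x; rewrite inE => /sub xab.
  by rewrite !fctE F'E.
- move=> x y /sub + /sub; rewrite /= !in_itv/= => /andP[ax _] /andP[_ yb] xy.
  by apply: Flt => //; exact: ltW.
- by move=> x /subset_itv_oo_cc /sub; exact: cF'.
- by apply/cvg_ex; exists (derive1 F (u n)); apply/cvg_at_right_filter/cF'.
- by apply/cvg_ex; exists (derive1 F (v n)); apply/cvg_at_left_filter/cF'.
- split; first by move=> x /subset_itv_oo_cc /sub; exact: derF.
  + exact/cvg_at_right_filter/cFin.
  + exact/cvg_at_left_filter/cFin.
- apply: continuous_in_subspaceT => y; rewrite inE /= in_itv/= => /andP[uy yv].
  apply: cG; rewrite in_itv/= (lt_le_trans _ uy) ?(le_lt_trans yv)//.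
    by have := Fin _ vnab; rewrite in_itv => /andP[].
  by have := Fin _ unab; rewrite in_itv => /andP[].
Unshelve. all: by end_near. Qed.

End substitution_oo.

(** * The beta integral: shift identity, splitting and finiteness *)

Section beta.
Context {R : realType}.
Notation mu := (@lebesgue_measure R).
Implicit Types a b x : R.

(** Substitution with the constant [G] equal to 1 turns the integral of F' into the length of []F a,
    F b[]; positivity of [f] makes [F] increasing. *)
Lemma integral_derive_itvoo (F f : R -> R) a b : a < b ->
  (forall x : R, x \in `]a, b[ -> is_derive x 1 F (f x)) ->
  {in `]a, b[, continuous f} -> {in `]a, b[, forall x, 0 < f x} ->
  F x @[x --> a^'+] --> F a -> F x @[x --> b^'-] --> F b ->
  (\int[mu]_(x in `]a, b[) (f x)%:E = (F b - F a)%:E)%E.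
Proof.
move=> ab dF cf f0 Fa Fb.
have Fab : F a <= F b.
  have cF : {within `[a, b], continuous F}.
    apply/continuous_within_itvP => //; split => // x /dF[d _].
    exact/differentiable_continuous/derivable1_diffP.
  apply/ltW; apply: (@gtr0_derive1_lt_cc _ F a b) => //.
  - by move=> x /dF[].
  - by move=> x xab; have d := dF _ xab; rewrite derive1E derive_val f0.
  - by rewrite bound_itvE ltW.
  - by rewrite bound_itvE ltW.
transitivity (\int[mu]_(x in `]a, b[) (cst 1 (F x) * f x)%:E)%E.
  by apply: eq_integral => x _; rewrite mul1r.
rewrite -integration_by_substitution_oo//; last by move=> x _; exact: cvg_cst.
rewrite (integral_cst mu (measurable_itv _) 1%:E) mul1e.
apply: etrans (lebesgue_measure_itv _) _; rewrite /= lte_fin.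
have [/lt_eqF//|Fba|->] := ltgtP (F a) (F b).
- by rewrite leNgt Fba in Fab.
- by rewrite subrr.
Qed.

Lemma powR_le1 a x : 0 <= a -> 0 < x -> x <= 1 -> x `^ a <= 1.
Proof.
move=> a0 x0 x1; have <- : 1 `^ a = 1 :> R by rewrite powR1.
by rewrite ge0_ler_powR ?nnegrE ?(ltW x0).
Qed.

Lemma continuous_scale k (f : R -> R) x : continuous_at x f ->
  continuous_at x (fun x => k * f x).
Proof. by move=> cf; apply: cvgM; [exact: cvg_cst|exact: cf]. Qed.

Lemma continuous_powR_gt0 a x : 0 < x -> continuous_at x (fun x => x `^ a).
Proof.
move=> x0; apply/differentiable_continuous/derivable1_diffP.
exact: (@ex_derive _ _ _ _ _ _ _ (is_derive1_powR a x0)).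
Qed.

Lemma continuous_onem_powR a x : x < 1 ->
  continuous_at x (fun x => (1 - x) `^ a).
Proof.
move=> x1.
apply: (@continuous_comp _ _ _ (fun x => 1 - x) (fun x => x `^ a)).
  by apply: cvgB; [exact: cvg_cst|exact: cvg_id].
by apply: continuous_powR_gt0; rewrite subr_gt0.
Qed.

Lemma is_derive_onem_powR a x : x < 1 ->
  is_derive x 1 (fun x => (1 - x) `^ a) (- (a * (1 - x) `^ (a - 1))).
Proof.
move=> x1; have x0 : 0 < 1 - x by rewrite subr_gt0.
have h : is_derive x 1 (fun x => 1 - x) (-1).
  have := is_deriveB (is_derive_cst (1 : R) x 1) (is_derive_id x (1 : R)).
  by rewrite sub0r.
have := @is_derive1_comp R (fun x => x `^ a) (fun x => 1 - x) x _ _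
  (is_derive1_powR a x0) h.
by rewrite mulrN1.
Qed.

Lemma onem_cvg_at_left1 : 1 - x @[x --> (1:R)^'-] --> (0:R)^'+.
Proof.
move=> A /= [e e0 He]; exists e => // x /= xe x1; apply: He => /=.
  by rewrite sub0r normrN.
by rewrite subr_gt0.
Qed.

Lemma powR_cvg_at_right0 a : 0 < a -> x `^ a @[x --> 0^'+] --> 0 `^ a.
Proof. by move=> a0; rewrite powR0 ?gt_eqF//; exact: powR_cvg0. Qed.

Lemma onem_powR_cvg_at_left1 a : 0 < a ->
  (1 - x) `^ a @[x --> 1^'-] --> (1 - 1) `^ a.
Proof.
move=> a0; rewrite subrr.
apply: (@cvg_comp _ _ _ (fun x => 1 - x) (fun x => x `^ a)).
  exact: onem_cvg_at_left1.
exact: powR_cvg_at_right0.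
Qed.

(** Euler's B(a, b), with values in the extended reals so that identities can be proved before
    finiteness is known and then used to establish it. *)
Definition beta_integral a b : \bar R :=
  (\int[mu]_(x in `]0%R, 1%R[) (x `^ (a - 1) * (1 - x) `^ (b - 1))%:E)%E.

Lemma continuous_beta_integrand a b x : x \in `]0, 1[ ->
  continuous_at x (fun x => x `^ a * (1 - x) `^ b).
Proof.
rewrite in_itv/= => /andP[x0 x1]; apply: cvgM.
- exact: continuous_powR_gt0.
- exact: continuous_onem_powR.
Qed.

Lemma measurable_itvoo (f : R -> R) a b : {in `]a, b[, continuous f} ->
  measurable_fun `]a, b[ (EFin \o f).
Proof.
move=> cf; apply/measurable_EFinP; apply: open_continuous_measurable_fun => //.
by move=> x; rewrite inE; exact: cf.
Qed.

Lemma beta_integral_ge0 a b : (0 <= beta_integral a b)%E.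
Proof. by apply: integral_ge0 => x _; rewrite lee_fin mulr_ge0 ?powR_ge0. Qed.

Lemma integral_onem_powR b : 0 < b ->
  (\int[mu]_(x in `]0%R, 1%R[) ((1 - x) `^ (b - 1))%:E = b^-1%:E)%E.
Proof.
move=> b0.
have dF x : x \in `]0, 1[ ->
    is_derive x 1 (fun x => - b^-1 * (1 - x) `^ b) ((1 - x) `^ (b - 1)).
  rewrite in_itv/= => /andP[x0 x1].
  apply: (is_derive_eq (is_deriveZ _ (is_derive_onem_powR b x1))).
  by rewrite /GRing.scale/= mulrNN mulKf ?gt_eqF.
rewrite (integral_derive_itvoo ltr01 dF)//.
- by rewrite subrr subr0 powR1 powR0 ?gt_eqF// mulr0 mulr1 sub0r opprK.
- by move=> x; rewrite in_itv/= => /andP[_]; exact: continuous_onem_powR.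
- by move=> x; rewrite in_itv/= => /andP[_ x1]; rewrite powR_gt0 ?subr_gt0.
- apply: cvgM; first exact: cvg_cst.
  by apply/cvg_at_right_filter/continuous_onem_powR.
- by apply: cvgM; [exact: cvg_cst|exact: onem_powR_cvg_at_left1].
Qed.

(* The derivative of x^a (1-x)^b has no sign; adding the increasing function
   1 - (1-x)^b makes it positive. *)
Lemma integral_derive_beta a b : 0 < a -> 0 < b ->
  (\int[mu]_(x in `]0%R, 1%R[) (a * (x `^ (a - 1) * (1 - x) `^ b) +
     b * ((1 - x `^ a) * (1 - x) `^ (b - 1)))%:E = 1%:E)%E.
Proof.
move=> a0 b0.
pose F x : R := x `^ a * (1 - x) `^ b - (1 - x) `^ b.
pose f x : R := a * (x `^ (a - 1) * (1 - x) `^ b) +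
  b * ((1 - x `^ a) * (1 - x) `^ (b - 1)).
have dF x : x \in `]0, 1[ -> is_derive x 1 F (f x).
  rewrite in_itv/= => /andP[x0 x1].
  have d1 := is_derive1_powR a x0; have d2 := is_derive_onem_powR b x1.
  apply: (is_derive_eq (is_deriveB (is_deriveM d1 d2) d2)).
  by rewrite /f /GRing.scale/=; ring.
rewrite (integral_derive_itvoo ltr01 dF)//.
- by rewrite /F subrr subr0 !powR1 !powR0 ?gt_eqF//; congr EFin; ring.
- move=> x; rewrite in_itv/= => /andP[x0 x1].
  apply: cvgD; (apply: cvgM; first exact: cvg_cst).
    by apply: continuous_beta_integrand; rewrite in_itv/= x0.
  apply: cvgM; last exact: continuous_onem_powR.
  by apply: cvgB; [exact: cvg_cst|exact: continuous_powR_gt0].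
- move=> x; rewrite in_itv/= => /andP[x0 x1].
  rewrite ltr_pwDl ?mulr_gt0 ?powR_gt0 ?subr_gt0//.
  rewrite !mulr_ge0 ?powR_ge0 ?(ltW b0)// subr_ge0.
  by rewrite powR_le1// ltW.
- apply: cvgB; last by apply/cvg_at_right_filter/continuous_onem_powR.
  apply: cvgM; first exact: powR_cvg_at_right0.
  by apply/cvg_at_right_filter/continuous_onem_powR.
- apply: cvgB; last exact: onem_powR_cvg_at_left1.
  apply: cvgM; last exact: onem_powR_cvg_at_left1.
  by apply/cvg_at_left_filter/continuous_powR_gt0.
Qed.

(** Integration by parts in nonnegative form. Adding [E] to the left side gives 1 by
    [integral_derive_beta]; adding it to the right side also gives 1, since x^a + (1 - x^a) = 1
    reduces the sum to the integral of b (1-x)^(b-1). *)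
Lemma beta_integral_shift a b : 0 < a -> 0 < b ->
  (a%:E * beta_integral a (b + 1) = b%:E * beta_integral (a + 1) b)%E.
Proof.
move=> a0 b0; rewrite /beta_integral !addrK.
pose E := (\int[mu]_(x in `]0%R, 1%R[)
  (b * ((1 - x `^ a) * (1 - x) `^ (b - 1)))%:E)%E.
have onem_ge0 x : x \in `]0, 1[ -> 0 <= 1 - x `^ a.
  rewrite in_itv/= => /andP[x0 x1]; rewrite subr_ge0.
  by rewrite powR_le1// ltW.
have cE : {in `]0, 1[, continuous
    (fun x => b * ((1 - x `^ a) * (1 - x) `^ (b - 1)))}.
  move=> x; rewrite in_itv/= => /andP[x0 x1].
  apply: continuous_scale.
  apply: cvgM; last exact: continuous_onem_powR.
  by apply: cvgB; [exact: cvg_cst|exact: continuous_powR_gt0].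
have cB c d : {in `]0, 1[, continuous (fun x : R => x `^ c * (1 - x) `^ d)}.
  by move=> x; exact: continuous_beta_integrand.
have cZ k c d : {in `]0, 1[, continuous
    (fun x : R => k * (x `^ c * (1 - x) `^ d))}.
  by move=> x x01; apply: cvgM; [exact: cvg_cst|exact: cB].
have pos k c d x : 0 < k -> (0 <= (k * (x `^ c * (1 - x) `^ d))%:E)%E.
  by move=> k0; rewrite lee_fin !mulr_ge0 ?powR_ge0// ltW.
have posE x : x \in `]0, 1[ ->
    (0 <= (b * ((1 - x `^ a) * (1 - x) `^ (b - 1)))%:E)%E.
  by move=> x01; rewrite lee_fin !mulr_ge0 ?powR_ge0 ?onem_ge0// ltW.
have Z k c d : 0 < k -> (k%:E * \int[mu]_(x in `]0%R, 1%R[)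
    (x `^ c * (1 - x) `^ d)%:E = \int[mu]_(x in `]0%R, 1%R[)
    (k * (x `^ c * (1 - x) `^ d))%:E)%E.
  move=> k0; rewrite -ge0_integralZl_EFin//.
  - by move=> x _; rewrite lee_fin mulr_ge0 ?powR_ge0.
  - exact: measurable_itvoo (cB _ _).
  - exact: ltW.
rewrite (Z _ _ _ a0) (Z _ _ _ b0).
have := integral_derive_beta a0 b0.
under eq_integral do rewrite EFinD.
rewrite (ge0_integralD mu (measurable_itv _) (fun x _ => pos _ _ _ x a0)
  (measurable_itvoo (cZ _ _ _)) posE (measurable_itvoo cE)).
rewrite -/E => AE.
have BE : (\int[mu]_(x in `]0%R, 1%R[) (b * (x `^ a * (1 - x) `^ (b - 1)))%:E
    + E = 1%:E)%E.
  rewrite -(ge0_integralD mu (measurable_itv _) (fun x _ => pos _ _ _ x b0)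
    (measurable_itvoo (cZ _ _ _)) posE (measurable_itvoo cE)).
  transitivity (b%:E * \int[mu]_(x in `]0%R, 1%R[) ((1 - x) `^ (b - 1))%:E)%E.
    rewrite -ge0_integralZl_EFin//; last 3 first.
    - by move=> x _; rewrite lee_fin powR_ge0.
    - apply: measurable_itvoo => x; rewrite in_itv/= => /andP[_].
      exact: continuous_onem_powR.
    - exact: ltW.
    by apply: eq_integral => x _; rewrite -EFinD -EFinM; congr EFin; ring.
  by rewrite integral_onem_powR// -EFinM divff ?gt_eqF.
(* Cancelling [E] in the extended reals requires it to be finite, which holds because it is a
   summand of 1. *)
have Efin : E \is a fin_num.
  by have : 1%:E \is a @fin_num R by []; rewrite -BE fin_numD => /andP[].
by rewrite -[LHS](addeK _ Efin) AE -BE addeK.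
Qed.

(** With first parameter above 1, the power of x is at most 1, so (1-x)^(b-1) dominates the
    integrand. *)
Lemma beta_integral_onem_fin a b : 0 < a -> 0 < b ->
  beta_integral (a + 1) b \is a fin_num.
Proof.
move=> a0 b0.
rewrite ge0_fin_numE ?beta_integral_ge0//.
apply: (@le_lt_trans _ _ (b^-1%:E)); last by rewrite ltry.
rewrite -integral_onem_powR//; apply: ge0_le_integral => //.
- by move=> x _; rewrite lee_fin mulr_ge0 ?powR_ge0.
- by apply: measurable_itvoo => x x01; exact: continuous_beta_integrand.
- apply: measurable_itvoo => x; rewrite in_itv/= => /andP[_].
  exact: continuous_onem_powR.
move=> x; rewrite /= in_itv/= => /andP[x0 x1].
by rewrite lee_fin addrK ler_piMl ?powR_ge0// powR_le1// ltW.
Qed.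

(** Multiply the integrand by 1 = x + (1 - x). *)
Lemma beta_integral_split a b :
  (beta_integral a b = beta_integral (a + 1) b + beta_integral a (b + 1))%E.
Proof.
rewrite -ge0_integralD//; last 4 first.
- by move=> x _; rewrite lee_fin mulr_ge0 ?powR_ge0.
- by apply: measurable_itvoo => x x01; exact: continuous_beta_integrand.
- by move=> x _; rewrite lee_fin mulr_ge0 ?powR_ge0.
- by apply: measurable_itvoo => x x01; exact: continuous_beta_integrand.
apply: eq_integral => x; rewrite inE /= in_itv/= => /andP[x0 x1].
have x10 : 0 < 1 - x by rewrite subr_gt0.
have E (c y : R) : 0 < y -> y `^ c = y `^ (c - 1) * y.
  move=> y0; have <- : y `^ (c - 1) * y `^ 1 = y `^ c.
    by rewrite -powRD ?subrK// (gt_eqF y0) implybT.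
  by rewrite powRr1// ltW.
rewrite -EFinD !addrK; congr EFin.
by rewrite (E a x x0) (E b (1 - x) x10); ring.
Qed.

(** Of the two terms of the splitting, the first is finite by domination, and the shift identity
    makes the second a finite multiple of the first. *)
Lemma beta_integral_fin a b : 0 < a -> 0 < b ->
  beta_integral a b \is a fin_num.
Proof.
move=> a0 b0; have fab := beta_integral_onem_fin a0 b0.
rewrite beta_integral_split fin_numD fab/=.
have : (a^-1%:E * (a%:E * beta_integral a (b + 1)))%E \is a fin_num.
  by rewrite (beta_integral_shift a0 b0) !fin_numM.
by rewrite muleA -EFinM (mulVf (lt0r_neq0 a0)) mul1e.
Qed.

Definition beta a b : R := fine (beta_integral a b).

Lemma betaE a b : 0 < a -> 0 < b -> beta_integral a b = (beta a b)%:E.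
Proof. by move=> a0 b0; rewrite fineK// beta_integral_fin. Qed.

Lemma beta_shift a b : 0 < a -> 0 < b ->
  a * beta a (b + 1) = b * beta (a + 1) b.
Proof.
move=> a0 b0; have := beta_integral_shift a0 b0.
rewrite (betaE a0 (addr_gt0 b0 ltr01)) (betaE (addr_gt0 a0 ltr01) b0).
by rewrite -!EFinM => -[].
Qed.

Lemma beta_split a b : 0 < a -> 0 < b ->
  beta a b = beta (a + 1) b + beta a (b + 1).
Proof.
move=> a0 b0; have := beta_integral_split a b.
rewrite (betaE a0 b0) (betaE a0 (addr_gt0 b0 ltr01)).
by rewrite (betaE (addr_gt0 a0 ltr01) b0) -EFinD => -[].
Qed.

(** Shift and splitting are two linear relations among B(a, b), B(a+1, b) and B(a, b+1); here the
    last one is eliminated. The sum is written [b + a] to match the order in the Pochhammer symbols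
    of the theorem. *)
Lemma beta_succl a b : 0 < a -> 0 < b ->
  beta (a + 1) b = a / (b + a) * beta a b.
Proof.
move=> a0 b0; have ab : b + a != 0 by rewrite gt_eqF ?addr_gt0.
have := beta_shift a0 b0; rewrite (beta_split a0 b0) => s.
by apply: (mulfI ab); rewrite mulrA mulrCA (divff ab) mulr1 mulrDr s; ring.
Qed.

End beta.

(** * Pochhammer quotients and special values of beta *)

Section beta_values.
Context {R : realType}.
Notation mu := (@lebesgue_measure R).
Implicit Types a b x p q : R.

Lemma beta_succr a b : 0 < a -> 0 < b ->
  beta a (b + 1) = b / (b + a) * beta a b.
Proof.
move=> a0 b0; have ab : b + a != 0 by rewrite gt_eqF ?addr_gt0.
have := beta_shift a0 b0; rewrite (beta_split a0 b0) => s.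
by apply: (mulfI ab); rewrite mulrA mulrCA (divff ab) mulr1 mulrDl s; ring.
Qed.

Lemma pochhammerS a n : pochhammer a n.+1 = pochhammer a n * (a + n%:R).
Proof. by rewrite /pochhammer big_ord_recr. Qed.

(** Each unit shift contributes (a+n)/(b+a+n), the quotient of the next factors of the two
    Pochhammer products. *)
Lemma beta_addnl a b n : 0 < a -> 0 < b ->
  beta (a + n%:R) b = pochhammer a n / pochhammer (b + a) n * beta a b.
Proof.
move=> a0 b0; elim: n => [|n IH].
  by rewrite addr0 /pochhammer !big_ord0 divff ?oner_neq0// mul1r.
rewrite -[in LHS]natr1 addrA (beta_succl (ltr_wpDr (ler0n _ n) a0) b0) IH.
rewrite !pochhammerS invfM.
by rewrite addrA; ring.
Qed.

Lemma beta_addnr a b n : 0 < a -> 0 < b ->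
  beta a (b + n%:R) = pochhammer b n / pochhammer (b + a) n * beta a b.
Proof.
move=> a0 b0; elim: n => [|n IH].
  by rewrite addr0 /pochhammer !big_ord0 divff ?oner_neq0// mul1r.
rewrite -[in LHS]natr1 addrA (beta_succr a0 (ltr_wpDr (ler0n _ n) b0)) IH.
rewrite !pochhammerS invfM.
by rewrite (addrAC b n%:R a); ring.
Qed.

Lemma powR_lt1 a x : 0 < a -> 0 < x -> x < 1 -> x `^ a < 1.
Proof.
move=> a0 x0 x1; have <- : 1 `^ a = 1 :> R by rewrite powR1.
by rewrite gt0_ltr_powR ?nnegrE ?(ltW x0).
Qed.

Lemma continuous_onem_powR_powR q b x : x \in `]0, 1[ -> 0 < q ->
  continuous_at x (fun x => (1 - x `^ q) `^ b).
Proof.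
rewrite in_itv/= => /andP[x0 x1] q0.
apply: (@continuous_comp _ _ _ (fun x => x `^ q) (fun x => (1 - x) `^ b)).
  exact: continuous_powR_gt0.
by apply: continuous_onem_powR; exact: powR_lt1.
Qed.

(** The substitution y = x^q, read from the beta integral back to x. The exponents are arbitrary:
    both sides may be infinite. *)
Lemma integral_powR_beta q a b : 0 < q ->
  (\int[mu]_(x in `]0%R, 1%R[) (x `^ a * (1 - x `^ q) `^ b)%:E =
   q^-1%:E * beta_integral ((a + 1) / q) (b + 1))%E.
Proof.
move=> q0; rewrite /beta_integral addrK -ge0_integralZl_EFin//; last 3 first.
- by move=> x _; rewrite lee_fin mulr_ge0 ?powR_ge0.
- by apply: measurable_itvoo => x; exact: continuous_beta_integrand.
- by rewrite invr_ge0 ltW.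
pose F x : R := x `^ q; pose f x : R := q * x `^ (q - 1).
pose G x : R := q^-1 * (x `^ ((a + 1) / q - 1) * (1 - x) `^ b).
have F0 : F 0 = 0 by rewrite /F powR0 ?gt_eqF.
have F1 : F 1 = 1 by rewrite /F powR1.
have cG : {in `]F 0, F 1[, continuous G}.
  rewrite F0 F1 => x x01; apply: continuous_scale.
  exact: continuous_beta_integrand.
have dF x : x \in `]0, 1[ -> is_derive x 1 F (f x).
  by rewrite in_itv/= => /andP[x0 _]; exact: is_derive1_powR.
have := integration_by_substitution_oo ltr01 dF _ _ _ _ cG.
rewrite F0 F1 => ->.
- apply: eq_integral => x; rewrite inE /= in_itv/= => /andP[x0 x1].
  congr EFin; rewrite /G /f /F -powRrM.
  have -> : q * ((a + 1) / q - 1) = a + 1 - q by field; rewrite gt_eqF.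
  have -> : x `^ a = x `^ (a + 1 - q) * x `^ (q - 1).
    by rewrite -powRD ?(gt_eqF x0) ?implybT//; congr (_ `^ _); ring.
  by field; rewrite gt_eqF.
- move=> x; rewrite in_itv/= => /andP[x0 _].
  by apply: continuous_scale; exact: continuous_powR_gt0.
- by move=> x; rewrite in_itv/= => /andP[x0 _]; rewrite mulr_gt0 ?powR_gt0.
- by rewrite -{2}F0; exact: powR_cvg_at_right0.
- by rewrite -{2}F1; apply/cvg_at_left_filter/continuous_powR_gt0.
- move=> x _; rewrite !mulr_ge0 ?powR_ge0// invr_ge0 ltW//.
Qed.

Lemma beta1r b : 0 < b -> beta 1 b = b^-1.
Proof.
move=> b0; rewrite /beta /beta_integral -[RHS]/(fine b^-1%:E).
rewrite -integral_onem_powR//; congr fine; apply: eq_integral => x _.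
by rewrite subrr powRr0 mul1r.
Qed.

(** The integral of 1 over []0, 1[] is evaluated twice: directly, and as a B(a, 1) through the
    substitution y = x^(1/a). *)
Lemma beta1l a : 0 < a -> beta a 1 = a^-1.
Proof.
move=> a0; have := @integral_powR_beta a^-1 0 0; rewrite invr_gt0 => /(_ a0).
have <- : (\int[mu]_(x in `]0%R, 1%R[) ((1 - x) `^ (1 - 1))%:E =
    \int[mu]_(x in `]0%R, 1%R[) (x `^ 0 * (1 - x `^ a^-1) `^ 0)%:E)%E.
  by apply: eq_integral => x _; rewrite subrr !powRr0 mul1r.
rewrite integral_onem_powR// !add0r invrK mul1r betaE// -EFinM invr1.
by move=> -[] /(congr1 ( *%R a^-1)); rewrite mulr1 mulKf ?gt_eqF.
Qed.

End beta_values.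

(** * Integrals and derivatives involving the generalized sine *)

Section sin_pq.
Context {R : realType}.
Notation mu := (@lebesgue_measure R).
Variables p q : R.
Hypotheses (p1 : 1 < p) (q0 : 0 < q).
Let k (t : R) : R := ((1 - t `^ q) `^ p^-1)^-1.
Let A := arcsin_pq p q.

Let p_gt0 : 0 < p. Proof. exact: lt_trans ltr01 p1. Qed.

Let k_gt0 x : x \in `]0, 1[ -> 0 < k x.
Proof.
rewrite in_itv/= => /andP[x0 x1].
by rewrite invr_gt0 powR_gt0// subr_gt0 powR_lt1.
Qed.

Let k_powR x : k x = (1 - x `^ q) `^ (- p^-1).
Proof. by rewrite powRN. Qed.

Let k_cont : {in `]0, 1[, continuous k}.
Proof.
move=> x x01; rewrite (_ : k = fun x => (1 - x `^ q) `^ (- p^-1)).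
  exact: continuous_onem_powR_powR.
by apply/funext => y; rewrite k_powR.
Qed.

Let onem_invp_gt0 : 0 < 1 - p^-1.
Proof. by rewrite subr_gt0 invf_lt1. Qed.

Let k_measurable : measurable_fun `[(0 : R), 1] (EFin \o k).
Proof.
apply/emeasurable_fun_itv_bndo_bndcP/emeasurable_fun_itv_obnd_cbndP.
exact: measurable_itvoo.
Qed.

Let integral_k : (\int[mu]_(t in `[0%R, 1%R]) (k t)%:E =
  (q^-1 * beta q^-1 (1 - p^-1))%:E)%E.
Proof.
rewrite integral_itv_bndoo; last exact: measurable_itvoo.
transitivity (\int[mu]_(x in `]0%R, 1%R[)
    (x `^ 0 * (1 - x `^ q) `^ (- p^-1))%:E)%E.
  by apply: eq_integral => x _; rewrite k_powR powRr0 mul1r.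
rewrite integral_powR_beta// add0r mul1r (addrC (- _)) betaE ?invr_gt0//.
Qed.

Lemma arcsin_pq1 : A 1 = q^-1 * beta q^-1 (1 - p^-1).
Proof. by rewrite /A /arcsin_pq /Rintegral integral_k. Qed.

(** [k] is nonnegative and its integral is a finite beta value (1 - 1/p > 0), so the singularity at
    t = 1 needs no separate estimate. *)
Let k_integrable : mu.-integrable `[0, 1] (EFin \o k).
Proof.
apply/integrableP; split; first exact: k_measurable.
suff -> : (\int[mu]_(x in `[0%R, 1%R]) `|(EFin \o k) x| =
    \int[mu]_(x in `[0%R, 1%R]) (k x)%:E)%E by rewrite integral_k ltry.
apply: eq_integral => x _.
by rewrite /= ger0_norm ?invr_ge0 ?powR_ge0.
Qed.

Let A0 : A 0 = 0.
Proof. by rewrite /A /arcsin_pq set_itv1 Rintegral_set1. Qed.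

Let A_cont : {within `[0, 1], continuous A}.
Proof. exact: (parameterized_integral_continuous ler01 k_integrable). Qed.

Let dA (x : R) : x \in `]0, 1[ -> is_derive x 1 A (k x).
Proof.
move=> x01; have := x01; rewrite in_itv/= => /andP[x0 x1].
have [] := continuous_FTC1_closed x1 k_integrable x0 (k_cont x01).
by move=> dA kE; rewrite -kE derive1E; exact: derivableP.
Qed.

Let A_incr : {in `[0, 1] &, {homo A : x y / x < y}}.
Proof.
apply: gtr0_derive1_lt_cc => //.
- by move=> x /dA[].
- by move=> x x01; have d := dA x01; rewrite derive1E derive_val k_gt0.
Qed.

Let A_inj : {in `[0, 1]%classic &, injective A}.
Proof.
move=> x y /set_mem x01 /set_mem y01 Axy.
have [/A_incr|/A_incr|//] := ltgtP x y.
- by move=> /(_ x01 y01); rewrite Axy ltxx.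
- by move=> /(_ y01 x01); rewrite Axy ltxx.
Qed.

Let sinK x : x \in `[0, 1] -> sin_pq p q (A x) = x.
Proof. by move=> x01; apply: (pinvKV _ A_inj); rewrite inE. Qed.

Let in_itvA y : y \in `]0, A 1[ -> exists2 x, x \in `]0, 1[ & A x = y.
Proof.
rewrite in_itv/= => /andP[y0 y1].
have y01 : `[A 0, A 1]%classic y by rewrite /= in_itv/= A0 !ltW.
have [|x] := segment_continuous_le_surjective ler01 _ A_cont y01.
  by rewrite A0 ltW// (lt_trans y0).
rewrite /= in_itv/= => /andP[x0 x1] Axy; exists x => //.
rewrite in_itv/= !lt_neqAle x0 x1 !andbT; apply/andP; split.
  by apply: contraTneq y0 => x0E; rewrite -Axy -x0E A0 ltxx.
by apply: contraTneq y1 => x1E; rewrite -Axy x1E ltxx.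
Qed.

(** The inverse function theorems for continuity and derivative ask for the cancellation on a whole
    neighbourhood of x. *)
Let near_sinK (x : R) : x \in `]0, 1[ -> \forall z \near x, sin_pq p q (A z) = z.
Proof.
move=> x01; near=> z; apply: sinK; apply: subset_itv_oo_cc.
by near: z; exact: near_in_itvoo.
Unshelve. all: by end_near. Qed.

Let near_A_cont (x : R) : x \in `]0, 1[ -> \forall z \near x, continuous_at z A.
Proof.
move=> x01; near=> z; apply/differentiable_continuous/derivable1_diffP.
have : z \in `]0, 1[ by near: z; exact: near_in_itvoo.
by move=> /dA[].
Unshelve. all: by end_near. Qed.

Let sin_cont (x : R) : x \in `]0, 1[ -> continuous_at (A x) (sin_pq p q).
Proof.
move=> x01.
exact: nbhs_singleton (near_can_continuous (near_sinK x01) (near_A_cont x01)).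
Qed.

Let comp_sin_cont (g : R -> R) : {in `]0, 1[, continuous g} ->
  {in `]0, A 1[, continuous (g \o sin_pq p q)}.
Proof.
move=> cg y /in_itvA[x x01 <-]; apply: continuous_comp; first exact: sin_cont.
by rewrite sinK; [exact: cg|exact: subset_itv_oo_cc].
Qed.

(** Substitution t = A x: [sin_pq] cancels [A], and the extra factor is the derivative [k] of
    [A]. *)
Lemma integral_comp_sin_pq (g : R -> R) : {in `]0, 1[, continuous g} ->
  {in `]0, 1[, forall x, 0 <= g x} ->
  (\int[mu]_(t in `]0%R, arcsin_pq p q 1%R[) (g (sin_pq p q t))%:E =
   \int[mu]_(x in `]0%R, 1%R[) (g x * ((1 - x `^ q) `^ p^-1)^-1)%:E)%E.
Proof.
move=> cg g0; have [_ A0r A1l] := (continuous_within_itvP A ltr01).1 A_cont.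
have := @integration_by_substitution_oo R A k (g \o sin_pq p q) _ _ ltr01 dA
  k_cont k_gt0 A0r A1l.
rewrite A0 => -> //.
- apply: eq_integral => x; rewrite inE => x01; rewrite /= sinK//.
  exact: subset_itv_oo_cc.
- exact: comp_sin_cont.
- move=> y /in_itvA[x x01 <-]; rewrite /= sinK ?g0//.
  exact: subset_itv_oo_cc.
Qed.

Lemma measurable_comp_sin_pq (g : R -> R) : {in `]0, 1[, continuous g} ->
  measurable_fun `]0, arcsin_pq p q 1[ (fun t => (g (sin_pq p q t))%:E).
Proof. by move=> cg; apply: measurable_itvoo; exact: comp_sin_cont. Qed.

(** At t = A x the inverse function rule gives the derivative 1 / k x. *)
Lemma derive1_on_sin_pq t : t \in `]0, arcsin_pq p q 1[ ->
  derive1_on `[0, arcsin_pq p q 1] (sin_pq p q) t =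
  (1 - sin_pq p q t `^ q) `^ p^-1.
Proof.
move=> t01; have [x x01 Ax] := in_itvA t01.
have -> : sin_pq p q t = x by rewrite -Ax sinK//; exact: subset_itv_oo_cc.
have := is_derive_inverse (near_sinK x01) (near_A_cont x01) (dA x01).
rewrite gt_eqF ?k_gt0// => /(_ isT); rewrite invrK Ax => dsin.
transitivity (derive1 (sin_pq p q) t); last first.
  by rewrite derive1E derive_val.
rewrite /derive1_on /derive1; congr (lim (_ @ _)).
(* As t is interior, t + h stays in the segment for small h, so restricting the filter to the
   segment does not change it. *)
have near_t : \forall h \near (0 : R)^', `[0, arcsin_pq p q 1]%classic (h + t).
  have ht : h + t @[h --> (0 : R)^'] --> t.
    rewrite -[X in _ --> X]add0r; apply: cvgD; last exact: cvg_cst.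
    exact: cvg_within.
  near=> h; apply: subset_itv_oo_cc; near: h.
  exact: ht _ (near_in_itvoo t01).
rewrite predeqE => P; split => [wP|P0]; last exact: filterS P0.
by apply: filterS2 near_t wP => h Dh; apply.
Unshelve. all: by end_near. Qed.

End sin_pq.

(** * Half periods as beta values, including the conventional cases *)

Lemma hoelder_conjugate_gt1 (R : realType) (p : R) : 1 < p ->
  hoelder_conjugate p%:E = (p / (p - 1))%:E.
Proof.
move=> p1; have p0 : p != 0 by rewrite gt_eqF// (lt_trans ltr01).
rewrite /hoelder_conjugate/= eqe (negbTE p0) -EFinB inver.
by rewrite gt_eqF ?subr_gt0// -EFinM.
Qed.

Lemma onem_inv_hoelder_conjugate (R : realType) (p : R) : 1 < p ->
  1 / fine (hoelder_conjugate p%:E) = 1 - p^-1.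
Proof.
move=> p1; rewrite hoelder_conjugate_gt1//=; field.
by rewrite !gt_eqF ?subr_gt0// (lt_trans ltr01).
Qed.

(** The convention at q = 1 fits the general formula, because B(1, 1 - 1/p) = 1 / (1 - 1/p) is the
    conjugate exponent of p. *)
Lemma half_pi_pq (R : realType) (p q : R) : 1 < p -> 1 <= q ->
  pi_pq p%:E q / 2 = q^-1 * beta q^-1 (1 - p^-1).
Proof.
move=> p1 q1; rewrite /pi_pq; case: eqVneq => [->|_]; last first.
  rewrite -arcsin_pq1//; first by rewrite mulrC mulKf.
  exact: lt_le_trans ltr01 q1.
rewrite mulrC mulKf// invr1 mul1r beta1r.
  by rewrite -onem_inv_hoelder_conjugate// div1r invrK.
by rewrite subr_gt0 invf_lt1// (lt_trans ltr01).
Qed.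

(** The convention for p = +oo is the same formula with 1/p read as 0, since B(1/q, 1) = q. *)
Lemma half_pi_pqy (R : realType) (q : R) : 0 < q ->
  pi_pq +oo%E q / 2 = q^-1 * beta q^-1 1.
Proof.
move=> q0; rewrite /pi_pq divff// beta1l ?invr_gt0// invrK mulVf//.
by rewrite gt_eqF.
Qed.

(** The conjugate w of v satisfies 1 - 1/w = 1/v; the case v = 1 falls under the convention for
    +oo. *)
Lemma half_pi_hoelder_conjugate (R : realType) (v q : R) : 1 <= v -> 1 <= q ->
  pi_pq (hoelder_conjugate v%:E) q / 2 = q^-1 * beta q^-1 v^-1.
Proof.
rewrite le_eqVlt => /predU1P[<-|v1] q1.
  by rewrite hoelder_conjugate1 half_pi_pqy ?invr1// (lt_le_trans ltr01).
have v0 : 0 < v by exact: lt_trans ltr01 v1.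
have w1 : 1 < v / (v - 1) by rewrite ltr_pdivlMr ?subr_gt0// mul1r gtrBl.
rewrite (hoelder_conjugate_gt1 v1) (half_pi_pq w1 q1); congr (_ * beta _ _).
by field; rewrite !gt_eqF ?subr_gt0.
Qed.

(** * The sine and cosine integrals *)

Unset Implicit Arguments.

Theorem theorem3p4 (R : realType) (p q : R) (n : nat) (hp : 1 < p) (hq : 1 < q) :
  (forall r u : R, -1 < r <= q - 1 -> 1 / u = (r + 1) / q ->
    (\int[lebesgue_measure]_(t in `[0%R, (pi_pq p%:E q / 2)%R])
       ((sin_pq p q t) `^ (q * n%:R + r))%:E)%E =
    (u * pochhammer (1 / u) n /
       (q * pochhammer (1 / fine (hoelder_conjugate p%:E) + 1 / u) n) *
       (pi_pq p%:E u / 2))%:E) /\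
  (forall r v : R, 1 - p < r <= 1 -> 1 / v = (r + p - 1) / p ->
    (\int[lebesgue_measure]_(t in `[0%R, (pi_pq p%:E q / 2)%R])
       ((cos_pq p q t) `^ (p * n%:R + r))%:E)%E =
    (pochhammer (1 / v) n / pochhammer (1 / v + 1 / q) n *
       (pi_pq (hoelder_conjugate v%:E) q / 2))%:E).
Proof.
have p0 : 0 < p := lt_trans ltr01 hp.
have q0 : 0 < q := lt_trans ltr01 hq.
have H : pi_pq p%:E q / 2 = arcsin_pq p q 1.
  by rewrite half_pi_pq ?arcsin_pq1 ?(ltW hq).
have onem_p : 0 < 1 - p^-1 by rewrite subr_gt0 invf_lt1.
split=> [r u /andP[r_gt r_le] uE|r v /andP[r_gt r_le] vE].
(* The bounds on r say exactly that 0 < 1/u <= 1; r = q - 1 is the conventional case u = 1. *)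
- have u'0 : 0 < u^-1 by rewrite -div1r uE divr_gt0//; lra.
  have u0 : 0 < u by rewrite -invr_gt0.
  have u1 : 1 <= u.
    by rewrite -(invf_le1 u0) -div1r uE ler_pdivrMr// mul1r -lerBrDr.
  set c := q * n%:R + r.
  have cont : {in `]0, 1[, continuous (fun x : R => x `^ c)}.
    by move=> x; rewrite in_itv/= => /andP[x0 _]; exact: continuous_powR_gt0.
  rewrite [X in `[_, X]]H integral_itv_bndoo; last first.
    exact: (measurable_comp_sin_pq hp q0 cont).
  rewrite (integral_comp_sin_pq hp q0 cont); last by move=> x _; exact: powR_ge0.
  under eq_integral do rewrite -powRN.
  (* The term q n in the exponent becomes the integer shift n of the first beta parameter. *)
  have cE : (c + 1) / q = u^-1 + n%:R.
    by rewrite -(div1r u) uE /c; field; rewrite gt_eqF.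
  rewrite integral_powR_beta// (addrC (- _)) cE betaE//; last exact: ltr_wpDr.
  rewrite half_pi_pq// onem_inv_hoelder_conjugate// div1r.
  (* The factor u cancels the [u^-1] contained in half of pi_{p,u}; the [q^-1] comes from y =
     x^q. *)
  rewrite -EFinM beta_addnl// invfM; congr EFin.
  rewrite !mulrA; congr (_ * _); set d := (pochhammer (1 - _ + _) n)^-1.
  by field; rewrite !gt_eqF.
have v'0 : 0 < v^-1 by rewrite -div1r vE divr_gt0//; lra.
have v0 : 0 < v by rewrite -invr_gt0.
have v1 : 1 <= v.
  by rewrite -(invf_le1 v0) -div1r vE ler_pdivrMr// mul1r; lra.
set c := p * n%:R + r.
have cont : {in `]0, 1[, continuous
    (fun x : R => ((1 - x `^ q) `^ p^-1) `^ c)}.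
  move=> x x01; rewrite (_ : (fun x : R => _) =
      fun x => (1 - x `^ q) `^ (p^-1 * c)).
    exact: continuous_onem_powR_powR.
  by apply/funext => y; rewrite powRrM.
have cosE t : t \in `]0, arcsin_pq p q 1[ ->
    cos_pq p q t = (1 - sin_pq p q t `^ q) `^ p^-1.
  by move=> t01; rewrite /cos_pq H derive1_on_sin_pq.
(* The formula for [cos_pq] is available on the open interval only, which suffices since the
   endpoints form a null set. *)
have eq_cos : {in `]0, arcsin_pq p q 1[%classic,
    (fun t => (((1 - sin_pq p q t `^ q) `^ p^-1) `^ c)%:E) =1
    (fun t => (cos_pq p q t `^ c)%:E)}.
  by move=> t; rewrite inE => t01; rewrite cosE.
rewrite [X in `[_, X]]H integral_itv_bndoo; last first.
  apply: (eq_measurable_fun _ eq_cos).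
  exact: (measurable_comp_sin_pq hp q0 cont).
transitivity (\int[lebesgue_measure]_(t in `]0%R, arcsin_pq p q 1%R[)
    (((1 - sin_pq p q t `^ q) `^ p^-1) `^ c)%:E)%E.
  by apply: eq_integral => t; rewrite inE => t01; rewrite cosE.
rewrite (integral_comp_sin_pq hp q0 cont); last by move=> x _; exact: powR_ge0.
(* The cosine power contributes the exponent c/p and the factor [k] contributes -1/p; here p n
   becomes a shift by n of the second beta parameter. *)
have cE : p^-1 * c - p^-1 + 1 = v^-1 + n%:R.
  by rewrite -(div1r v) vE /c; field; rewrite gt_eqF.
transitivity (\int[lebesgue_measure]_(x in `]0%R, 1%R[)
    (x `^ 0 * (1 - x `^ q) `^ (p^-1 * c - p^-1))%:E)%E.
  apply: eq_integral => x; rewrite inE /= in_itv/= => /andP[x0 x1].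
  rewrite powRr0 mul1r powRB -?powRrM//.
  by rewrite subr_eq0 (gt_eqF (powR_lt1 q0 x0 x1)) implybT.
rewrite integral_powR_beta// cE add0r !div1r betaE ?invr_gt0//; last first.
  exact: ltr_wpDr.
rewrite half_pi_hoelder_conjugate ?(ltW hq)// -EFinM beta_addnr ?invr_gt0//.
by congr EFin; rewrite mulrCA.
Qed.
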